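(* Let $D$ be an integral domain, let $\star$ be a semistar operation on $D$, and let $n:=\widetilde{\star}\text{-}\dim(D)$. Then $$n+1\le\star[X]\text{-}\dim(D[X])\le 2n+1.$$
   Context: For a domain $D$ with quotient field $K$, $\overline{\mathcal F}(D)$ is the set of nonzero $D$-submodules of $K$ and $f(D)$ the set of nonzero finitely generated $D$-submodules of $K$. A semistar operation on $D$ is a map $\star:\overline{\mathcal F}(D)\to\overline{\mathcal F}(D)$, $E\mapsto E^\star$, such that for all $0\ne x\in K$ and $E,F\in\overline{\mathcal F}(D)$: $(xE)^\star=xE^\star$; $E\subseteq F$ implies $E^\star\subseteq F^\star$; $E\subseteq E^\star=(E^\star)^\star$. Define $E^{\star_f}:=\bigcup\{F^\star\mid F\in f(D),F\subseteq E\}$. A nonzero ideal $I$ of $D$ is a quasi-$\star$-ideal if $I^\star\cap D=I$; a quasi-$\star$-prime is a prime quasi-$\star$-ideal; $\operatorname{QMax}^{\star}(D)$ is the set of maximal elements of the set of proper quasi-$\star$-ideals (they are prime). $\widetilde\star$ is the semistar operation $E^{\widetilde\star}:=\bigcap\{ED_P\mid P\in\operatorname{QMax}^{\star_f}(D)\}$ (equal to $K$ if $\operatorname{QMax}^{\star_f}(D)=\emptyset$). $\star\text{-}\dim(D)$ is the supremum of the integers $n$ such that there is a chain $(0)\subsetneq P_1\subsetneq\cdots\subsetneq P_n$ with each $P_i$ a quasi-$\star$-prime of $D$; it is $0$ if there are no quasi-$\star$-primes. Usual conventions for $\infty$ apply. Let $X,Y$ be indeterminates, $D_1:=D[X]$,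 $K_1:=K(X)$, $\Theta_1^{\star}:=\{Q\in\operatorname{Spec}(D_1)\mid Q\cap D=(0)\text{ or }(Q\cap D)^{\star_f}\subsetneq D^{\star}\}$, $\mathfrak S_1^\star:=D_1[Y]\setminus\bigcup\{Q[Y]\mid Q\in\Theta_1^\star\}$. The semistar operation $\star[X]$ on $D[X]$ is defined by $E^{\star[X]}:=E[Y]_{\mathfrak S_1^\star}\cap K_1$ for $E\in\overline{\mathcal F}(D_1)$. *)

(* Defs.v *)
From mathcomp Require Import all_boot all_order all_algebra.
From mathcomp Require Import fraction.
From mathcomp Require Import all_classical constructive_ereal.

Set Implicit Arguments.
Unset Strict Implicit.
Unset Printing Implicit Defensive.

Import Order.TTheory GRing.Theory Num.Theory.
Local Open Scope classical_set_scope.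
Local Open Scope ring_scope.

Notation tofrac := (@FracField.tofrac _).
Local Notation "x %:F" := (tofrac x).

(* The quotient field of D is {fraction D}; the quotient field K(X) of D[X] is
   {fraction {poly D}}. The ideals of ring_quotient are boolean and proper;
   here submodules, ideals and primes are arbitrary classical sets. *)

Section Modules.
Variable D : idomainType.
Local Notation K := {fraction D}.

Definition embed (A : set D) : set K := tofrac @` A.

Definition submodule (E : set K) : Prop :=
  E 0 /\ forall (a : D) (u v : K), E u -> E v -> E (a%:F * u + v).

Definition nz_submodule (E : set K) : Prop :=
  submodule E /\ exists2 x, E x & x != 0.

Definition Dspan (s : seq K) : set K :=
  [set z | exists a : 'I_(size s) -> D, z = \sum_(i < size s) (a i)%:F * s`_i].

Definition nz_fg_submodule (F : set K) : Prop :=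
  nz_submodule F /\ exists s : seq K, F = Dspan s.

Definition is_ideal (I : set D) : Prop :=
  I 0 /\ forall a u v : D, I u -> I v -> I (a * u + v).

Definition is_proper_ideal (I : set D) : Prop := is_ideal I /\ ~ I 1.

Definition is_prime_ideal (P : set D) : Prop :=
  is_proper_ideal P /\ forall u v : D, P (u * v) -> P u \/ P v.

Definition set_prod (E F : set K) : set K :=
  [set z | exists s : seq (K * K),
     (forall p, p \in s -> E p.1 /\ F p.2) /\ z = \sum_(p <- s) p.1 * p.2].

Definition localization (P : set D) : set K :=
  [set z | exists a s : D, ~ P s /\ z = a%:F / s%:F].

End Modules.

(* A map on nonzero submodules is encoded as a map on all sets; its values
   outside nonzero submodules are unconstrained and never used. *)
Record semistar (D : idomainType) := Semistar {
  semistar_fun :> set {fraction D} -> set {fraction D};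
  semistar_nz : forall E, nz_submodule E -> nz_submodule (semistar_fun E);
  semistar_scale : forall x E, x != 0 -> nz_submodule E ->
    semistar_fun [set x * e | e in E] = [set x * e | e in semistar_fun E];
  semistar_mono : forall E F, nz_submodule E -> nz_submodule F ->
    E `<=` F -> semistar_fun E `<=` semistar_fun F;
  semistar_ext : forall E, nz_submodule E -> E `<=` semistar_fun E;
  semistar_idem : forall E, nz_submodule E ->
    semistar_fun (semistar_fun E) = semistar_fun E
}.

Section Operations.
Variable D : idomainType.
Local Notation K := {fraction D}.
Implicit Type star : set K -> set K.

Definition star_f star (E : set K) : set K :=
  \bigcup_(F in [set F | nz_fg_submodule F /\ F `<=` E]) star F.

Definition quasi_ideal star (I : set D) : Prop :=
  [/\ is_ideal I, exists2 x, I x & x != 0 &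
      tofrac @^-1` star (embed I) = I].

Definition quasi_prime star (P : set D) : Prop :=
  quasi_ideal star P /\ is_prime_ideal P.

Definition QMax star (M : set D) : Prop :=
  [/\ quasi_ideal star M, is_proper_ideal M &
      forall I, quasi_ideal star I -> is_proper_ideal I -> M `<=` I -> I = M].

(* The intersection over the empty family is all of K. *)
Definition star_tilde star (E : set K) : set K :=
  \bigcap_(P in QMax (star_f star)) set_prod E (localization P).

Definition prime_chain star (n : nat) : Prop :=
  exists P : nat -> set D,
    [/\ P 0%N = [set 0],
        forall i, (i < n)%N -> P i `<` P i.+1 &
        forall i, (0 < i <= n)%N -> quasi_prime star (P i)].

(* The supremum is taken in the integers extended by +oo and -oo, where every
   set of natural numbers has one; n = 0 always occurs. *)
Definition star_dim star : \bar int :=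
  supremum 0%E [set n%:Z%:E | n in [set n : nat | prime_chain star n]].

Lemma prime_chain0 star :
  prime_chain star 0.
Proof. by exists (fun=> [set 0]); split => // -[]. Qed.

Lemma star_dim_sup star :
  supremums [set n%:Z%:E | n in [set n : nat | prime_chain star n]]%E (star_dim star).
Proof.
rewrite /star_dim /supremum; set A := image _ _.
have A0 : A 0%:E%E by exists 0%N => //; exact: prime_chain0.
case: eqP => [A_0|_]; first by move: A0; rewrite A_0.
suff [x Ax] : exists x, supremums A x by exact: (xgetPex _ (ex_intro _ x Ax)).
have [[m mub]|nub] := pselect (exists m, forall n, prime_chain star n -> (n <= m)%N).
  have ex : exists n, `[< prime_chain star n >] by exists 0%N; apply/asboolP; exact: prime_chain0.
  have mub' n : `[< prime_chain star n >] -> (n <= m)%N by move=> /asboolP/mub.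
  case: (ex_maxnP ex mub') => M /asboolP cM Mmax.
  exists M%:Z%:E%E; split.
    by move=> _ [k ck <-]; rewrite lee_fin lez_nat; apply: Mmax; apply/asboolP.
  by move=> y; apply; exists M.
exists +oo%E; split; first by move=> x _; exact: leey.
move=> [r||] ub; rewrite ?leey //; last by have := ub _ A0.
exfalso; apply: nub; exists `|r|%N => n cn.
have : (n%:Z%:E <= r%:E)%E by apply: ub; exists n.
rewrite lee_fin => h; rewrite -lez_nat; apply: le_trans h _; exact: lez_abs.
Qed.

End Operations.

Section PolynomialExtension.
Variable D : idomainType.
Local Notation D1 := {poly D}.
Local Notation K1 := {fraction {poly D}}.
Variable star : set {fraction D} -> set {fraction D}.

Definition contraction (Q : set D1) : set D := polyC @^-1` Q.

Definition Theta1 (Q : set D1) : Prop :=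
  is_prime_ideal Q /\
  (contraction Q = [set 0] \/
   star_f star (embed (contraction Q)) `<` star (embed setT)).

Definition poly_in (R : nzRingType) (E : set R) : set {poly R} :=
  [set p | forall i, E p`_i].

Definition S1 : set {poly D1} := ~` \bigcup_(Q in Theta1) poly_in Q.

(* Both D1[Y] and K1 are embedded in K1(Y) = {fraction {poly K1}}. *)
Definition star_X (E : set K1) : set K1 :=
  [set z | exists (f : {poly K1}) (s : {poly D1}),
     [/\ poly_in E f, S1 s &
         (z%:P)%:F = f%:F / (map_poly tofrac s)%:F
           :> {fraction {poly K1}}]].

End PolynomialExtension.

(* Main.v *)
Require Import Defs.
From mathcomp Require Import all_boot all_order all_algebra.
From mathcomp Require Import fraction.
From mathcomp Require Import all_classical constructive_ereal.

(** Call an ideal [I] of [D] good when [1] is not in [I^(star_f)]. By Zorn a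
nonzero good ideal lies in a member of [QMax star_f], so the quasi-primes of
[star_tilde] are the nonzero good primes. If [Q] is a prime of [D[X]] whose
contraction is not good, a finitely generated [J] inside the contraction has
[1] in [J^star], and a polynomial in [Y] with generators of [J] as coefficients
lies in [Q[Y]] and in [S1]; so the quasi-primes of [star_X] are the nonzero
primes with good contraction. The bounds are then the classical ones for the
Krull dimension of [D[X]]: a chain [P_0 < ... < P_n] gives
[P_0[X] < ... < P_n[X] < (P_n, X)], and three comparable distinct primes of
[D[X]] never have the same contraction, so in a chain of [D[X]] every second
prime contributes to a chain of [D]. *)

Set Implicit Arguments.
Unset Strict Implicit.
Unset Printing Implicit Defensive.

Import Order.TTheory GRing.Theory Num.Theory.
Local Open Scope ereal_scope.

Section Ideals.
Local Open Scope classical_set_scope.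
Local Open Scope ring_scope.

(** * Closure properties of ideals and primes *)

Section Basics.
Context {D : idomainType} {I : set D}.
Hypothesis idI : is_ideal I.

Lemma ideal0 : I 0. Proof. by case: idI. Qed.

Lemma idealD u v : I u -> I v -> I (u + v).
Proof. by case: idI => _ H Iu Iv; rewrite -[u]mul1r; apply: H. Qed.

Lemma idealMl a u : I u -> I (a * u).
Proof. by case: idI => I0 H Iu; rewrite -[_ * _]addr0; apply: H. Qed.

Lemma idealMr a u : I u -> I (u * a).
Proof. by rewrite mulrC; exact: idealMl. Qed.

Lemma idealN u : I u -> I (- u).
Proof. by rewrite -mulN1r; exact: idealMl. Qed.

Lemma idealB u v : I u -> I v -> I (u - v).
Proof. by move=> Iu Iv; apply: idealD => //; exact: idealN. Qed.

Lemma ideal_sum (T : Type) (r : seq T) (P : pred T) (F : T -> D) :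
  (forall i, P i -> I (F i)) -> I (\sum_(i <- r | P i) F i).
Proof.
move=> IF; apply: (big_ind (fun x => I x)) => //; first exact: ideal0.
exact: idealD.
Qed.

End Basics.

Section Primes.
Context {D : idomainType} {P : set D}.
Hypothesis prP : is_prime_ideal P.

Lemma prime_ideal : is_ideal P. Proof. by case: prP => -[]. Qed.

Lemma prime_not1 : ~ P 1. Proof. by case: prP => -[]. Qed.

Lemma primeM_notin u v : ~ P u -> ~ P v -> ~ P (u * v).
Proof. by case: prP => _ H nu nv /H[]. Qed.

Lemma primeX_notin u n : ~ P u -> ~ P (u ^+ n).
Proof.
move=> nPu; elim: n => [|n IH]; first by rewrite expr0; exact: prime_not1.
by rewrite exprS; exact: primeM_notin.
Qed.

End Primes.

Lemma zero_prime (D : idomainType) : is_prime_ideal [set 0 : D].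
Proof.
split; first split; first split => //=.
- by move=> a u v /= -> ->; rewrite mulr0 addr0.
- by move=> /= /eqP; rewrite oner_eq0.
- by move=> u v /= /eqP; rewrite mulf_eq0 => /orP[]/eqP; [left|right].
Qed.

(** * Primes of [D[X]] and their contractions to [D] *)

Section Polynomials.
Context {D : idomainType}.
Local Notation D1 := {poly D}.

Lemma contraction_prime (Q : set D1) :
  is_prime_ideal Q -> is_prime_ideal (contraction Q).
Proof.
move=> prQ; have idQ := prime_ideal prQ.
split; first split; first split; rewrite /contraction /=.
- by rewrite polyC0; exact: ideal0 idQ.
- move=> a u v Qu Qv; rewrite polyCD polyCM.
  by apply: (idealD idQ) => //; apply: (idealMl idQ).
- by rewrite polyC1; exact: prime_not1 prQ.
- by case: prQ => _ H u v; rewrite polyCM => /H.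
Qed.

Lemma contractionS (Q Q' : set D1) :
  Q `<=` Q' -> contraction Q `<=` contraction Q'.
Proof. by move=> QQ' x /= /QQ'. Qed.

Lemma contraction0 : contraction [set 0 : D1] = [set 0].
Proof.
by apply/seteqP; split=> x /= => [/eqP|->]; rewrite ?polyC_eq0 // => /eqP.
Qed.

Lemma contraction_poly_in (P : set D) : is_ideal P ->
  contraction (poly_in P) = P.
Proof.
move=> idP; apply/seteqP; split=> x /=.
  by move/(_ 0); rewrite coefC.
by move=> Px i; rewrite coefC; case: ifP => // _; exact: ideal0 idP.
Qed.

Lemma poly_in0 : poly_in [set 0 : D] = [set 0].
Proof.
apply/seteqP; split=> p /=; last by move=> -> i; rewrite coef0.
by move=> p0; apply/polyP => i; rewrite coef0 p0.
Qed.

(** As in Gauss's lemma: if [u_i] and [v_j] are the coefficients of lowest index outside [P], every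
    other term of the coefficient of index [i + j] in [u * v] lies in [P], so that coefficient is
    outside [P]. *)
Lemma poly_in_prime (P : set D) :
  is_prime_ideal P -> is_prime_ideal (poly_in P).
Proof.
move=> prP; have idP := prime_ideal prP.
split; first split; first split.
- by move=> i; rewrite coef0; exact: ideal0 idP.
- move=> a u v Pu Pv i; rewrite coefD coefM.
  by apply: (idealD idP) => //; apply: (ideal_sum idP) => j _; exact: (idealMl idP).
- by move/(_ 0); rewrite coef1; exact: prime_not1 prP.
move=> u v Puv; apply: contrapT => /not_orP[nu nv].
have first_notin w : ~ poly_in P w ->
    exists i, ~ P w`_i /\ forall j, (j < i)%N -> P w`_j.
  move=> /existsNP[k nPk].
  have ex : exists i, ~~ `[< P w`_i >] by exists k; apply/asboolPn.
  have [i /asboolPn nPi imin] := ex_minnP ex.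
  exists i; split=> // j ji; apply: contrapT => /asboolPn/imin.
  by rewrite leqNgt ji.
have [i [nPi ilt]] := first_notin u nu.
have [j [nPj jlt]] := first_notin v nv.
apply: (primeM_notin prP nPi nPj).
have := Puv (i + j)%N; rewrite coefM.
have hi : (i < (i + j).+1)%N by rewrite ltnS leq_addr.
rewrite (bigD1 (Ordinal hi)) //= addKn => Psum.
rewrite -[_ * _](addrK (\sum_(k < (i + j).+1 | k != Ordinal hi)
   u`_k * v`_(i + j - k))).
apply: (idealB idP) => //; apply: (ideal_sum idP) => k kNi.
have [ki|ik] := ltnP k i; first by apply: (idealMr idP); exact: ilt.
apply: (idealMl idP); apply: jlt.
have {}ik : (i < k)%N.
  by rewrite ltn_neqAle ik andbT; apply: contra kNi => /eqP e; apply/eqP/val_inj.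
by rewrite ltn_subLR ?ltn_add2r // -ltnS.
Qed.

(* The ideal generated by [P] and [X]. *)
Definition coef0_in (P : set D) : set D1 := [set p | P p`_0].

Lemma coef0_in_prime (P : set D) :
  is_prime_ideal P -> is_prime_ideal (coef0_in P).
Proof.
move=> prP; have idP := prime_ideal prP.
split; first split; first split; rewrite /coef0_in /=.
- by rewrite coef0; exact: ideal0 idP.
- move=> a u v Pu Pv; rewrite coefD coef0M.
  by apply: (idealD idP) => //; exact: (idealMl idP).
- by rewrite coef1; exact: prime_not1 prP.
- by case: prP => _ H u v; rewrite coef0M => /H.
Qed.

Lemma contraction_coef0_in (P : set D) : contraction (coef0_in P) = P.
Proof. by apply/seteqP; split=> x; rewrite /contraction /coef0_in /= coefC. Qed.

Lemma poly_in_proper (P P' : set D) : is_ideal P -> is_ideal P' ->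
  P `<` P' -> poly_in P `<` poly_in P'.
Proof.
move=> idP idP' [sPP' nP'P]; split=> [p Pp i|sub]; first exact: sPP' (Pp i).
apply: nP'P; rewrite -(contraction_poly_in idP) -(contraction_poly_in idP').
exact: contractionS.
Qed.

Lemma poly_in_coef0_in (P : set D) : is_proper_ideal P ->
  poly_in P `<` coef0_in P.
Proof.
move=> [idP nP1]; split=> [p /(_ 0)//|/(_ 'X)]; rewrite /coef0_in /= coefX.
by move=> /(_ (ideal0 idP) 1%N); rewrite coefX.
Qed.

Lemma min_size_witness (A : set D1) (p : D1) : A p ->
  exists2 f, A f & forall g, A g -> (size f <= size g)%N.
Proof.
move=> Ap.
have ex : exists n, `[< exists2 f, A f & size f = n >].
  by exists (size p); apply/asboolP; exists p.
have [n /asboolP[f Af fn] nmin] := ex_minnP ex.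
exists f => // g Ag; rewrite fn; apply: nmin; apply/asboolP; by exists g.
Qed.

Lemma size_sub_lead (f g : D1) : f != 0 -> size f = size g ->
  lead_coef f = lead_coef g -> (size (f - g)%R < size f)%N.
Proof.
move=> f0 sfg lfg; have s0 : (0 < size f)%N by rewrite size_poly_gt0.
rewrite -[X in (_ < X)%N](prednK s0) ltnS; apply/leq_sizeP => i.
rewrite coefB leq_eqVlt => /orP[/eqP <-|].
  by move: lfg; rewrite !lead_coefE -sfg => ->; rewrite subrr.
rewrite prednK // => si; rewrite !nth_default ?subrr //.
by rewrite -sfg.
Qed.

(** Otherwise the leading monomial of [f] lies in [Q], and subtracting it leaves a shorter element
    of [Q'] outside [Q]. *)
Lemma min_lead_notin (Q Q' : set D1) (f : D1) :
  is_ideal Q -> is_ideal Q' -> contraction Q' `<=` contraction Q ->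
  Q `<=` Q' -> Q' f -> ~ Q f ->
  (forall g, Q' g -> ~ Q g -> (size f <= size g)%N) ->
  ~ contraction Q' (lead_coef f).
Proof.
move=> idQ idQ' sQ'Q sQQ' Q'f nQf fmin lf.
have f0 : f != 0 by apply/eqP => f0; apply: nQf; rewrite f0; exact: ideal0 idQ.
have Qm : Q ((lead_coef f)%:P * 'X^((size f).-1)).
  by apply: (idealMr idQ); exact: sQ'Q.
set m := _ * _ in Qm.
have sm : (size (f - m)%R < size f)%N.
  apply: size_sub_lead; rewrite // /m mul_polyC.
    rewrite size_scale ?lead_coef_eq0 // size_polyXn prednK //.
    by rewrite size_poly_gt0.
  by rewrite lead_coefZ lead_coefXn mulr1.
have Q'fm : Q' (f - m) by apply: (idealB idQ') => //; exact: sQQ'.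
have nQfm : ~ Q (f - m).
  by move=> Qfm; apply: nQf; rewrite -(subrK m f); exact: (idealD idQ).
by have := fmin _ Q'fm nQfm; rewrite leqNgt sm.
Qed.

(* With [f] of minimal degree in [Q1 \ Q0] and [g] of minimal degree in
   [Q2 \ Q1], the leading coefficients lie outside the common contraction.
   Eliminating the leading term of [g] with [f] forces [deg g < deg f], and the
   pseudo-division of [f] by [g] then puts a multiple of [f] by a power of
   [lead_coef g] in [Q0]. *)
Lemma no_three_chain (Q0 Q1 Q2 : set D1) :
  is_prime_ideal Q0 -> is_prime_ideal Q1 -> is_prime_ideal Q2 ->
  Q0 `<` Q1 -> Q1 `<` Q2 -> ~ contraction Q2 `<=` contraction Q0.
Proof.
move=> pr0 pr1 pr2 [s01 n10] [s12 n21] c20.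
have [[id0 id1] id2] := (prime_ideal pr0, prime_ideal pr1, prime_ideal pr2).
have c10 : contraction Q1 `<=` contraction Q0.
  exact: subset_trans (contractionS s12) c20.
have c21 : contraction Q2 `<=` contraction Q1.
  exact: subset_trans c20 (contractionS s01).
have witness (A B : set D1) : ~ B `<=` A -> exists p, B p /\ ~ A p.
  by move=> /existsNP[p /not_implyP H]; exists p.
have [p0 wp0] := witness _ _ n10.
have [f [f1 nf0] fmin] := min_size_witness (A := [set p | Q1 p /\ ~ Q0 p]) wp0.
have [p1 wp1] := witness _ _ n21.
have [g [g2 ng1] gmin] := min_size_witness (A := [set p | Q2 p /\ ~ Q1 p]) wp1.
have la : ~ contraction Q1 (lead_coef f).
  by apply: (@min_lead_notin Q0) => // h h1 h0; exact: fmin.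
have lb : ~ contraction Q2 (lead_coef g).
  by apply: (@min_lead_notin Q1) => // h h1 h0; exact: gmin.
have nz (Q : set D1) p : is_ideal Q -> ~ Q p -> p != 0.
  by move=> idQ nQp; apply/eqP => p0'; apply: nQp; rewrite p0'; exact: ideal0 idQ.
have f0 := nz _ _ id0 nf0; have g0 := nz _ _ id1 ng1.
have [sfg|sgf] := leqP (size f) (size g).
  pose u := lead_coef f *: g.
  pose v := (lead_coef g *: 'X^(size g - size f)) * f.
  have lf0 : lead_coef f != 0 by rewrite lead_coef_eq0.
  have lg0 : lead_coef g != 0 by rewrite lead_coef_eq0.
  have su : size u = size g by rewrite size_scale.
  have u0 : u != 0 by rewrite -size_poly_eq0 su size_poly_eq0.
  have : Q2 (u - v) /\ ~ Q1 (u - v).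
    have v1 : Q1 v by exact: (idealMl id1).
    split.
      apply: (idealB id2); last exact: s12.
      by rewrite /u -mul_polyC; exact: (idealMl id2).
    move=> uv1; have : Q1 u by rewrite -(subrK v u); exact: (idealD id1).
    by rewrite /u -mul_polyC; exact: (primeM_notin pr1).
  move=> /gmin; rewrite -su leqNgt size_sub_lead //.
    rewrite su /v -scalerAl size_scale // size_mul ?f0 ?monic_neq0 ?monicXn //.
    by rewrite size_polyXn addSn /= subnK.
  by rewrite /u /v -scalerAl !lead_coefZ lead_coefM lead_coefXn mul1r mulrC.
(* A constant [g] would lie in the common contraction, hence in [Q1]. Positive degree makes the
   quotient [q] shorter than [f]. *)
have sg1 : (1 < size g)%N.
  rewrite ltnNge; apply/negP => /size1_polyC gC; apply: ng1; rewrite gC.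
  by apply: c21; rewrite /contraction /= -gC.
have := Pdiv.Idomain.divp_eq f g.
set k := scalp _ _; set q := (f %/ g)%R; set r := (f %% g)%R => fqr.
have sr : (size r < size g)%N by rewrite Pdiv.Idomain.ltn_modpN0.
have sq : (size q < size f)%N.
  rewrite /q Pdiv.Idomain.size_divp // ltn_subrL -subn1 subn_gt0 sg1 /=.
  by rewrite size_poly_gt0.
have r2 : Q2 r.
  have -> : r = lead_coef g ^+ k *: f - q * g by rewrite fqr addrC addKr.
  apply: (idealB id2); last exact: (idealMl id2).
  by rewrite -mul_polyC; apply: (idealMl id2); exact: s12.
(* The remainder descends twice: minimality of [g] puts it in [Q1], then minimality of [f] puts it
   in [Q0]. *)
have r1 : Q1 r.
  by apply: contrapT => nr1; have := gmin _ (conj r2 nr1); rewrite leqNgt sr.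
have r0 : Q0 r.
  apply: contrapT => nr0; have := fmin _ (conj r1 nr0).
  by rewrite leqNgt (ltn_trans sr sgf).
(* Since [q * g] is in [Q1] and [g] is not, primality gives [q] in [Q1]; minimality of [f] then
   gives [q] in [Q0]. *)
have q1 : Q1 q.
  apply: contrapT => nq1; apply: (primeM_notin pr1 nq1 ng1).
  have -> : q * g = lead_coef g ^+ k *: f - r by rewrite fqr addrK.
  apply: (idealB id1) => //; rewrite -mul_polyC; exact: (idealMl id1).
have q0 : Q0 q.
  by apply: contrapT => nq0; have := fmin _ (conj q1 nq0); rewrite leqNgt sq.
have : Q0 (lead_coef g ^+ k *: f).
  by rewrite fqr; apply: (idealD id0) => //; exact: (idealMr id0).
rewrite -mul_polyC rmorphXn /=; apply: (primeM_notin pr0) => //.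
by apply: (primeX_notin pr0) => /s01/s12.
Qed.

End Polynomials.
End Ideals.

Section Semistar.
Local Open Scope classical_set_scope.
Local Open Scope ring_scope.
Local Notation tofrac := (@FracField.tofrac _).
Local Notation "x %:F" := (tofrac x).

(** * Finitely generated submodules of the quotient field *)

Section Spans.
Context {D : idomainType}.
Local Notation K := {fraction D}.

Lemma submoduleD (E : set K) u v : submodule E -> E u -> E v -> E (u + v).
Proof. by case=> _ H Eu Ev; rewrite -[u]mul1r -tofrac1; exact: H. Qed.

Lemma submoduleZ (E : set K) a u : submodule E -> E u -> E (a%:F * u).
Proof. by case=> E0 H Eu; rewrite -[_ * _]addr0; exact: H. Qed.

Lemma Dspan_submodule (s : seq K) : submodule (Dspan s).
Proof.
split.
  by exists (fun=> 0); rewrite big1 // => i _; rewrite tofrac0 mul0r.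
move=> a _ _ [f ->] [g ->]; exists (fun i => a * f i + g i).
rewrite mulr_sumr -big_split /=; apply: eq_bigr => i _.
by rewrite tofracD tofracM mulrDl mulrA.
Qed.

Lemma mem_Dspan (s : seq K) x : x \in s -> Dspan s x.
Proof.
move=> xs; have ix : (index x s < size s)%N by rewrite index_mem.
exists (fun i => if i == Ordinal ix then 1 else 0).
rewrite (bigD1 (Ordinal ix)) //= eqxx tofrac1 mul1r nth_index // big1 ?addr0 //.
by move=> i /negPf->; rewrite tofrac0 mul0r.
Qed.

Lemma Dspan_sub (s : seq K) (E : set K) : submodule E ->
  (forall x, x \in s -> E x) -> Dspan s `<=` E.
Proof.
move=> smE sE _ [f ->]; apply: (big_ind (fun x => E x)).
- by case: smE.
- by move=> u v; exact: submoduleD.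
- by move=> i _; apply: (submoduleZ _ smE); apply: sE; exact: mem_nth.
Qed.

Lemma nz_fg_Dspan (s : seq K) x : x \in s -> x != 0 ->
  nz_fg_submodule (Dspan s).
Proof.
move=> xs x0; split; last by exists s.
by split; [exact: Dspan_submodule|exists x => //; exact: mem_Dspan].
Qed.

(** Concatenating generators shows that the union defining [star_f] is directed. *)
Lemma nz_fg_directed (E F G : set K) : submodule E ->
  nz_fg_submodule F -> nz_fg_submodule G -> F `<=` E -> G `<=` E ->
  exists H, [/\ nz_fg_submodule H, F `<=` H, G `<=` H & H `<=` E].
Proof.
move=> smE [[_ [x Fx x0]] [s Fs]] [_ [t Gt]]; subst F G => sE tE.
have ss : Dspan s `<=` Dspan (s ++ t).
  apply: Dspan_sub; first exact: Dspan_submodule.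
  by move=> y ys; apply: mem_Dspan; rewrite mem_cat ys.
exists (Dspan (s ++ t)); split => //.
- split; last by exists (s ++ t).
  by split; [exact: Dspan_submodule | exists x => //; exact: ss].
- apply: Dspan_sub; first exact: Dspan_submodule.
  by move=> y yt; apply: mem_Dspan; rewrite mem_cat yt orbT.
- apply: Dspan_sub => // y; rewrite mem_cat => /orP[] /mem_Dspan; [exact: sE|exact: tE].
Qed.

Lemma embed_submodule (I : set D) : is_ideal I -> submodule (embed I).
Proof.
move=> idI; split; first by exists 0; [exact: ideal0 idI|rewrite tofrac0].
move=> a _ _ [u Iu <-] [v Iv <-]; exists (a * u + v); last first.
  by rewrite tofracD tofracM.
by case: idI => _; apply.
Qed.

Lemma embedE (I : set D) x : embed I x%:F <-> I x.
Proof.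
split=> [[y Iy /eqP]|Ix]; last by exists x.
by rewrite tofrac_eq => /eqP <-.
Qed.

Lemma embed_nz_submodule (I : set D) x : is_ideal I -> I x -> x != 0 ->
  nz_submodule (embed I).
Proof.
move=> idI Ix x0; split; first exact: embed_submodule.
by exists x%:F; [exact/embedE|rewrite tofrac_eq0].
Qed.

End Spans.

(** * The finite-type operation [star_f] *)

Section FiniteType.
Context {D : idomainType} (star : semistar D).
Local Notation K := {fraction D}.
Local Notation starf := (star_f star).

Lemma star_f_mono (E F : set K) : E `<=` F -> starf E `<=` starf F.
Proof.
move=> EF x [G [nzG GE] Gx]; exists G => //; split=> //.
exact: subset_trans EF.
Qed.

Lemma star_f_ext (E : set K) : nz_submodule E -> E `<=` starf E.
Proof.
move=> [smE [y Ey y0]] x Ex.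
(* The generator [y] keeps the span nonzero when [x] is zero. *)
have fgG : nz_fg_submodule (Dspan [:: y; x]).
  by apply: (nz_fg_Dspan (x := y)) => //; rewrite inE eqxx.
exists (Dspan [:: y; x]).
  split=> //; apply: Dspan_sub => // z.
  by rewrite !inE => /orP[]/eqP->.
apply: semistar_ext; first by case: fgG.
by apply: mem_Dspan; rewrite !inE eqxx orbT.
Qed.

(** By directedness one [G] serves for finitely many elements. This is what makes [star_f] of a
    nonzero submodule a submodule and yields idempotence. *)
Lemma star_f_seq (E : set K) (s : seq K) : nz_submodule E ->
  (forall x, x \in s -> starf E x) ->
  exists G, [/\ nz_fg_submodule G, G `<=` E & forall x, x \in s -> star G x].
Proof.
move=> [smE [y Ey y0]]; elim: s => [_|x s IH xsE].
  exists (Dspan [:: y]); split=> //.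
    by apply: (nz_fg_Dspan (x := y)) => //; rewrite inE eqxx.
  by apply: Dspan_sub => // z; rewrite inE => /eqP->.
have [|G [fgG GE sG]] := IH.
  by move=> z zs; apply: xsE; rewrite inE zs orbT.
have [H [fgH HE] Hx] := xsE x (mem_head _ _).
have [L [fgL HL GL LE]] := nz_fg_directed smE fgH fgG HE GE.
have [[nzH _] [[nzG _] [nzL _]]] := (fgH, (fgG, fgL)).
exists L; split=> // z; rewrite inE => /orP[/eqP->|/sG].
  exact: semistar_mono Hx.
exact: semistar_mono.
Qed.

Lemma star_f_submodule (E : set K) : nz_submodule E -> submodule (starf E).
Proof.
move=> nzE; split.
  by apply: star_f_ext => //; case: nzE => -[].
move=> a u v Eu Ev.
have [|G [fgG GE suv]] := star_f_seq (s := [:: u; v]) nzE.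
  by move=> x; rewrite !inE => /orP[]/eqP->.
exists G => //; have [[_ H] _] := semistar_nz star (proj1 fgG).
by apply: H; apply: suv; rewrite !inE eqxx ?orbT.
Qed.

(** Idempotence of [star_f]: the finitely many generators of [G] lie in a single [star H], so
    [star G] is contained in [star (star H) = star H]. *)
Lemma star_f_absorb (E F : set K) : nz_submodule E -> F `<=` starf E ->
  starf F `<=` starf E.
Proof.
move=> nzE FE x [G [fgG GF] Gx].
have [nzG [s Gs]] := fgG.
have [|H [fgH HE sH]] := star_f_seq (s := s) nzE.
  by move=> y ys; apply: FE; apply: GF; rewrite Gs; exact: mem_Dspan.
have nzH := proj1 fgH; have nzsH := semistar_nz star nzH.
exists H => //; rewrite -(semistar_idem star nzH); move: x Gx.
apply: semistar_mono => //; rewrite Gs; apply: Dspan_sub => //.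
by case: nzsH.
Qed.

(** * Good ideals, and the quasi-primes of [star_tilde] *)

Definition star_good (I : set D) := ~ starf (embed I) 1.

Lemma star_goodS (I J : set D) : I `<=` J -> star_good J -> star_good I.
Proof.
move=> IJ gJ I1; apply: gJ; move: I1; apply: star_f_mono.
by move=> _ [x /IJ Jx <-]; exists x.
Qed.

Lemma quasi_ideal_good (I : set D) :
  quasi_ideal starf I -> is_proper_ideal I -> star_good I.
Proof. by move=> [_ _ qI] [_ nI1] I1; apply: nI1; rewrite -qI /= tofrac1. Qed.

(** The zero module contains no nonzero finitely generated submodule, so the union defining [star_f]
    is empty there. *)
Lemma zero_good : star_good [set 0].
Proof.
move=> [F [[[_ [x Fx /eqP x0]] _] F0] _]; apply: x0.
by have [y /= -> <-] := F0 _ Fx; exact: tofrac0.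
Qed.

(** This translates the condition defining [Theta1] into goodness. *)
Lemma star_f_proper (I : set D) : is_ideal I ->
  starf (embed I) `<` star (embed setT) <-> star_good I.
Proof.
have nzT : nz_submodule (embed (@setT D)).
  by apply: (embed_nz_submodule (x := 1)) => //; exact: oner_neq0.
have T1 : embed (@setT D) 1 by rewrite -tofrac1; exact/embedE.
move=> idI; split=> [[_ nsub] [F [fgF FI] F1]|gI].
  have nzF := proj1 fgF; have nzsF := semistar_nz star nzF.
  (* As [star F] is a submodule containing [1], it contains [D], and idempotence then gives all of
     the star closure of [D]. *)
  apply: nsub => x Tx; exists F => //; rewrite -(semistar_idem star nzF).
  move: x Tx; apply: semistar_mono => // _ [y _ <-].
  by rewrite -[_%:F]mulr1; apply: submoduleZ => //; case: nzsF.
split=> [x [F [[nzF _] FI]]|sub]; last by apply/gI/sub/semistar_ext.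
by apply: semistar_mono => // y /FI [z _ <-]; exists z.
Qed.

(** Finite type is decisive: the generators of an [F] with [1] in [star F] already lie in one member
    of the chain. *)
Lemma good_bigcup (C : set (set D)) (X0 : set D) :
  C X0 -> total_on C subset -> (forall X, C X -> is_ideal X) ->
  (forall X, C X -> star_good X) ->
  star_good (\bigcup_(X in C) X).
Proof.
move=> CX0 totC idC gC [F [fgF FC] F1]; have [_ [s Fs]] := fgF.
have {}FC : forall x, x \in s -> embed (\bigcup_(X in C) X) x.
  by move=> x xs; apply: FC; rewrite Fs; exact: mem_Dspan.
have [X CX sX] : exists2 X, C X & forall x, x \in s -> embed X x.
  elim: s {Fs} FC => [_|x s IH FC]; first by exists X0.
  have [|X CX sX] := IH; first by move=> y ys; apply: FC; rewrite inE ys orbT.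
  have [y [Y CY Yy] yx] := FC x (mem_head _ _).
  have [XY|YX] := totC _ _ CX CY.
    exists Y => // z; rewrite inE => /orP[/eqP->|/sX[w /XY Yw <-]].
      by exists y.
    by exists w.
  exists X => // z; rewrite inE => /orP[/eqP->|/sX//].
  by exists y => //; exact: YX.
apply: (gC X CX); exists F => //; split=> //; rewrite Fs.
by apply: Dspan_sub => //; apply: embed_submodule; exact: idC.
Qed.

Lemma bigcup_ideal (C : set (set D)) (X0 : set D) :
  C X0 -> total_on C subset -> (forall X, C X -> is_ideal X) ->
  is_ideal (\bigcup_(X in C) X).
Proof.
move=> CX0 totC idC; split; first by exists X0 => //; exact: ideal0 (idC _ CX0).
move=> a u v [X CX Xu] [Y CY Yv].
have [XY|YX] := totC _ _ CX CY.
  by exists Y => //; have [_] := idC _ CY; apply=> //; exact: XY.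
by exists X => //; have [_] := idC _ CX; apply=> //; exact: YX.
Qed.

Lemma good_sub_maximal (I : set D) : is_ideal I -> star_good I ->
  exists M, [/\ is_ideal M, I `<=` M, star_good M &
    forall J, is_ideal J -> star_good J -> M `<=` J -> J = M].
Proof.
move=> idI gI.
(* The empty set is admitted only because [Zorn_bigcup] also asks for the union
   of the empty chain. *)
pose ok A := A = set0 \/ [/\ is_ideal A, I `<=` A & star_good A].
have [C Cok totC|M [okM Mmax]] := Zorn_bigcup (P := ok).
  (* Discarding the empty members leaves the union unchanged and makes every remaining member a good
     ideal. *)
  pose C' := [set X | C X /\ X !=set0].
  have C'ok X : C' X -> [/\ is_ideal X, I `<=` X & star_good X].
    by case=> /Cok[->|//] [x].
  have -> : \bigcup_(X in C) X = \bigcup_(X in C') X.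
    apply/seteqP; split=> x [X]; last by case=> CX _ Xx; exists X.
    by move=> CX Xx; exists X => //; split=> //; exists x.
  have [[X0 CX0]|C'0] := pselect (C' !=set0); last first.
    by left; rewrite -subset0 => x [X C'X _]; apply: C'0; exists X.
  have totC' : total_on C' subset by move=> X Y [CX _] [CY _]; exact: totC.
  have idC' X : C' X -> is_ideal X by move=> /C'ok[].
  right; split.
  - exact: (bigcup_ideal CX0).
  - by have [_ sI _] := C'ok _ CX0; move=> x /sI X0x; exists X0.
  - by apply: (good_bigcup CX0) => // X /C'ok[].
have {okM} : [/\ is_ideal M, I `<=` M & star_good M].
  case: okM => // M0; exfalso; apply: (Mmax I); last by right; split.
  by rewrite M0; split=> // /(_ 0 (ideal0 idI)).
case=> idM IM gM; exists M; split=> // J idJ gJ MJ.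
apply: contrapT => nJM; apply: (Mmax J); last first.
  by right; split=> //; exact: subset_trans MJ.
by split=> // JM; apply: nJM; apply/seteqP.
Qed.

(** A maximal good ideal [M] is a quasi-ideal: the trace on [D] of its [star_f] closure is an ideal
    containing [M], and it is good by [star_f_absorb], so it equals [M]. *)
Lemma good_sub_QMax (I : set D) x : is_ideal I -> I x -> x != 0 ->
  star_good I -> exists2 M, QMax starf M & I `<=` M.
Proof.
move=> idI Ix x0 gI; have [M [idM IM gM Mmax]] := good_sub_maximal idI gI.
exists M => //; have nzM := embed_nz_submodule idM (IM _ Ix) x0.
have prM : is_proper_ideal M.
  by split=> // M1; apply/gM/star_f_ext => //; rewrite -tofrac1; exact/embedE.
split=> // [|J qJ prJ]; last first.
  by apply: Mmax; [case: prJ => idJ _; exact: idJ|exact: quasi_ideal_good].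
have [sf0 sfD] := star_f_submodule nzM.
split=> //; first by exists x => //; exact: IM.
apply: Mmax.
- by split=> [|a u v /= Mu Mv]; rewrite /= ?tofrac0 // tofracD tofracM; exact: sfD.
- by apply: contra_not gM; apply: star_f_absorb => // _ [u Mu <-].
- by move=> u Mu; apply: star_f_ext => //; exact/embedE.
Qed.

(** The trace of [P D_M] on [D] is within [P]: a common denominator [s] outside [M], built by
    induction on the sum, is outside [P]; then [a * s] in [P] forces [a] in [P]. *)
Lemma set_prod_localization (P M : set D) a : is_prime_ideal P -> P `<=` M ->
  set_prod (embed P) (localization M) a%:F -> P a.
Proof.
move=> prP PM [r [rP az]]; have idP := prime_ideal prP.
have [s Ps [b Pb e]] : exists2 s, ~ P s &
    exists2 b, P b & (\sum_(p <- r) p.1 * p.2) * s%:F = b%:F.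
  elim: r {az} rP => [_|p r IH rP].
    exists 1; first exact: prime_not1.
    by exists 0; [exact: ideal0 idP|rewrite big_nil mul0r tofrac0].
  have [|s Ps [b Pb e]] := IH.
    by move=> q qr; apply: rP; rewrite inE qr orbT.
  have [[u Pu up] [c [t [Mt ctp]]]] := rP p (mem_head _ _).
  have Pt : ~ P t by move=> /PM.
  exists (t * s); first exact: primeM_notin.
  exists (u * c * s + t * b).
    apply: (idealD idP); last exact: (idealMl idP).
    by apply: (idealMr idP); exact: (idealMr idP).
  rewrite big_cons -up ctp !rmorphD !rmorphM /= -e mulrDl; congr (_ + _).
    have t0 : t%:F != 0.
      by rewrite tofrac_eq0; apply/eqP => t0; apply: Pt; rewrite t0; exact: ideal0 idP.
    by rewrite mulrA -(mulrA u%:F) divfK.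
  by rewrite mulrCA.
have : P (a * s).
  by move: e; rewrite -az -tofracM => /eqP; rewrite tofrac_eq => /eqP ->.
by case: prP => _ H /H[].
Qed.

(** If [P] is a quasi-prime, some [P D_M] omits [1], so [P] lies in the good ideal [M]. Conversely a
    good [P] lies in some [M] of [QMax], and the factor [P D_M] alone cuts the intersection with [D]
    down to [P]. *)
Lemma quasi_prime_tilde (P : set D) x : is_prime_ideal P -> P x -> x != 0 ->
  quasi_prime (star_tilde star) P <-> star_good P.
Proof.
move=> prP Px x0; have idP := prime_ideal prP; split=> [[[_ _ qP] _]|gP].
  have /existsNP[M /not_implyP[QM nM]] : ~ star_tilde star (embed P) 1.
    by rewrite -tofrac1 => P1; apply: (prime_not1 prP); rewrite -qP.
  suff PM : P `<=` M.
    by case: QM => qM prM _; exact: star_goodS (quasi_ideal_good qM prM).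
  (* An element [a] of [P] outside [M] would give [1 = a * a^-1] in [P D_M]. *)
  move=> a Pa; apply: contrapT => nMa; apply: nM.
  exists [:: (a%:F, a%:F^-1)]; split; last first.
    rewrite big_seq1 /= mulfV // tofrac_eq0; apply/eqP => a0; apply: nMa.
    by rewrite a0; case: QM => _ [idM _] _; exact: ideal0 idM.
  move=> p; rewrite inE => /eqP -> /=; split; first exact/embedE.
  by exists 1, a; rewrite tofrac1 mul1r.
have [M QM PM] := good_sub_QMax idP Px x0 gP.
split=> //; split=> //; first by exists x.
apply/seteqP; split=> [a /= /(_ M QM)|a Pa]; first exact: set_prod_localization.
move=> N [_ [_ nN1] _]; exists [:: (a%:F, 1)]; split.
  move=> p; rewrite inE => /eqP -> /=; split; first exact/embedE.
  by exists 1, 1; rewrite tofrac1 divr1.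
by rewrite big_seq1 /= mulr1.
Qed.

(** * The quasi-primes of [star_X] *)

Local Notation D1 := {poly D}.

(** Both alternatives in [Theta1] amount to goodness, because the zero ideal is good. *)
Lemma Theta1E (Q : set D1) : is_prime_ideal Q ->
  Theta1 star Q <-> star_good (contraction Q).
Proof.
move=> prQ; have idc := prime_ideal (contraction_prime prQ); split.
  by move=> [_ [->|/star_f_proper]]; [exact: zero_good|apply].
by move=> /(star_f_proper idc) gQ; split=> //; right.
Qed.

Lemma zero_Theta1 : Theta1 star [set 0 : D1].
Proof. by split; [exact: zero_prime|left; exact: contraction0]. Qed.

(** Clearing the denominator in [K1(Y)] turns membership into [p * s] having its coefficients in
    [I], which removes the fraction fields from later arguments. *)
Lemma preimage_star_X (I : set D1) (p : D1) :
  star_X star (embed I) p%:F <->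
  exists2 s, S1 star s & forall i, I (p * s`_i).
Proof.
(* Denominators are nonzero because the zero prime belongs to [Theta1]. *)
have s0 s : S1 star s ->
    (map_poly tofrac s)%:F != 0 :> {fraction {poly {fraction D1}}}.
  move=> Ss; rewrite tofrac_eq0; apply/eqP => /polyP s0; apply: Ss.
  exists [set 0]; first exact: zero_Theta1.
  move=> i; have := s0 i; rewrite coef_map coef0 => /eqP.
  by rewrite tofrac_eq0 => /eqP.
split=> [[f [s [If Ss e]]]|[s Ss Is]]; last first.
  exists (map_poly tofrac (p *: s)), s; split=> //.
    by move=> i; rewrite coef_map; apply/embedE; rewrite coefZ.
  by rewrite map_polyZ /= -mul_polyC tofracM mulfK ?s0.
exists s => // i; have /eqP : p%:F%:P%:F * (map_poly tofrac s)%:F = f%:F.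
  by rewrite e divfK ?s0.
rewrite -tofracM tofrac_eq => /eqP {}e.
have := If i; rewrite -e coefCM coef_map /= -tofracM.
by move/embedE.
Qed.

Lemma quasi_prime_star_X (Q : set D1) x : is_prime_ideal Q -> Q x -> x != 0 ->
  quasi_prime (star_X star) Q <-> star_good (contraction Q).
Proof.
move=> prQ Qx x0; have idQ := prime_ideal prQ; split=> [[[_ _ qQ] _]|gQ].
  move=> [F [[[_ [y Fy y0]] [t Ft]] FQ] F1].
  apply: (prime_not1 prQ); rewrite -qQ /=; apply/preimage_star_X.
  (* The generators of [F] are images of elements of [D], so they can serve as constant coefficients
     in [D[X]]. *)
  have tQ : exists2 r : seq D, t = map tofrac r & forall z, z \in r -> Q z%:P.
    have {F1 Fy}: forall z, z \in t -> embed (contraction Q) z.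
      by move=> z zt; apply: FQ; rewrite Ft; exact: mem_Dspan.
    elim: t {Ft} => [_|z t IH tQ]; first by exists [::].
    have [|r -> rQ] := IH; first by move=> w wt; apply: tQ; rewrite inE wt orbT.
    have [w Qw <-] := tQ z (mem_head _ _).
    by exists (w :: r) => // v; rewrite inE => /orP[/eqP->//|/rQ].
  have [r tr rQ] := tQ.
  have coefr i : (Poly (map polyC r))`_i = (r`_i)%:P.
    rewrite coef_Poly; have [ri|ir] := ltnP i (size r); first exact: nth_map.
    by rewrite !nth_default ?size_map.
  exists (Poly (map polyC r)) => [|i]; last first.
    rewrite mul1r coefr; have [ri|ir] := ltnP i (size r).
      by apply: rQ; exact: mem_nth.
    by rewrite nth_default // polyC0; exact: ideal0 idQ.
  (* If [Q'] in [Theta1] contained all these coefficients, its contraction would contain [F], and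
     [1] in [star F] would contradict goodness. *)
  move=> [Q' TQ' Q'r]; have prQ' := proj1 TQ'.
  have idc' := prime_ideal (contraction_prime prQ').
  apply: (proj1 (Theta1E prQ') TQ'); exists F => //; split.
    split; last by exists t.
    by split; [rewrite Ft; exact: Dspan_submodule|exists y].
  rewrite Ft; apply: Dspan_sub; first exact: embed_submodule.
  rewrite tr => _ /mapP[z /(nthP 0)[i _ <-] ->]; apply/embedE.
  by have := Q'r i; rewrite coefr.
split=> //; split=> //; first by exists x.
apply/seteqP; split=> [p /= /preimage_star_X [s Ss Qps]|p Qp /=].
  (* If [p] is not in [Q], primality puts every coefficient of [s] in [Q], itself a member of
     [Theta1], against [s] in [S1]. *)
  apply: contrapT => nQp; apply: Ss; exists Q; first exact/Theta1E.
  by move=> i; case: prQ => _ H; have [/nQp|] := H _ _ (Qps i).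
apply/preimage_star_X; exists 1; last by move=> i; exact: (idealMr idQ).
move=> [Q' [prQ' _] /(_ 0%N)]; rewrite coef1; exact: prime_not1 prQ'.
Qed.

End FiniteType.

(** * Transfer of prime chains between [D] and [D[X]] *)

Section Chains.
Context {D : idomainType} (star : semistar D).

Lemma chain_mem0 (R : idomainType) (P : nat -> set R) n : P 0%N = [set 0] ->
  (forall i, (i < n)%N -> P i `<` P i.+1) ->
  forall i, (i <= n)%N -> P i 0.
Proof.
move=> P0 Plt; elim=> [|i IH] lin; first by rewrite P0.
by have [sub _] := Plt i lin; apply: sub; apply: IH; exact: ltnW.
Qed.

Lemma chain_nonzero (R : idomainType) (P : nat -> set R) n : P 0%N = [set 0] ->
  (forall i, (i < n)%N -> P i `<` P i.+1) ->
  forall i, (0 < i <= n)%N -> exists2 x, P i x & x != 0.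
Proof.
move=> P0 Plt [|i] //= lin; have [_ /existsNP[x /not_implyP[Px nPx]]] := Plt i lin.
exists x => //; apply/eqP => x0; apply: nPx; rewrite x0.
by apply: (chain_mem0 P0 Plt); exact: ltnW.
Qed.

(** Goodness treats index [0] like the others: the zero ideal is good and prime, though it is never
    a quasi-prime. Strictness makes all later members nonzero. *)
Lemma prime_chainP (R : idomainType) (op : set {fraction R} -> set {fraction R})
    (good : set R -> Prop) n :
  good [set 0] ->
  (forall P x, is_prime_ideal P -> P x -> x != 0 ->
     quasi_prime op P <-> good P) ->
  prime_chain op n <-> exists P, [/\ P 0%N = [set 0],
    forall i, (i < n)%N -> P i `<` P i.+1,
    forall i, (i <= n)%N -> is_prime_ideal (P i) &
    forall i, (i <= n)%N -> good (P i)].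
Proof.
move=> good0 qprimeE; split=> [[P [P0 Plt qP]]|[P [P0 Plt prP gP]]]; exists P.
  have prP i : (i <= n)%N -> is_prime_ideal (P i).
    case: i => [_|i lin]; first by rewrite P0; exact: zero_prime.
    by have [] := qP i.+1 lin.
  split=> // -[_|i lin]; first by rewrite P0.
  have [x Px x0] := chain_nonzero P0 Plt (i := i.+1) lin.
  by apply/(qprimeE _ x (prP _ lin) Px x0); exact: qP.
split=> // i lin; have [x Px x0] := chain_nonzero P0 Plt lin.
have {}lin : (i <= n)%N by case/andP: lin.
by apply/(qprimeE _ x (prP _ lin) Px x0); exact: gP.
Qed.

Lemma prime_chain_tildeP n : prime_chain (star_tilde star) n <->
  exists P, [/\ P 0%N = [set 0],
    forall i, (i < n)%N -> P i `<` P i.+1,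
    forall i, (i <= n)%N -> is_prime_ideal (P i) &
    forall i, (i <= n)%N -> star_good star (P i)].
Proof.
by apply: prime_chainP; [exact: zero_good|move=> P x; exact: quasi_prime_tilde].
Qed.

Lemma prime_chain_XP n : prime_chain (star_X star) n <->
  exists Q, [/\ Q 0%N = [set 0],
    forall i, (i < n)%N -> Q i `<` Q i.+1,
    forall i, (i <= n)%N -> is_prime_ideal (Q i) &
    forall i, (i <= n)%N -> star_good star (contraction (Q i))].
Proof.
apply: (prime_chainP (good := fun Q => star_good star (contraction Q))).
  by rewrite contraction0; exact: zero_good.
by move=> Q x; exact: quasi_prime_star_X.
Qed.

Lemma prime_chain_lift n : prime_chain (star_tilde star) n ->
  prime_chain (star_X star) n.+1.
Proof.
move=> /prime_chain_tildeP[P [P0 Plt prP gP]]; apply/prime_chain_XP.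
exists (fun i => if (i <= n)%N then poly_in (P i) else coef0_in (P n)); split.
- by rewrite /= P0 poly_in0.
- move=> i; rewrite ltnS => lin; rewrite lin; case: ltnP => [iltn|nlei].
    by apply: poly_in_proper; [| |exact: Plt]; apply: prime_ideal; exact: prP.
  have -> : i = n by apply/eqP; rewrite eqn_leq lin.
  by apply: poly_in_coef0_in; case: (prP n (leqnn n)).
- move=> i _; case: ifP => lin; first exact/poly_in_prime/prP.
  exact/coef0_in_prime/prP.
- move=> i _; case: ifP => lin; last by rewrite contraction_coef0_in; exact: gP.
  by rewrite contraction_poly_in; [exact: gP|exact/prime_ideal/prP].
Qed.

(** Contracting the members of even index keeps the inclusions strict, by [no_three_chain] applied
    to three consecutive primes. *)
Lemma prime_chain_contract m : prime_chain (star_X star) m ->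
  prime_chain (star_tilde star) m./2.
Proof.
move=> /prime_chain_XP[Q [Q0 Qlt prQ gQ]]; apply/prime_chain_tildeP.
have le2 i : (i <= m./2)%N -> (i.*2 <= m)%N 
  by move=> lim; rewrite -(odd_double_half m) (leq_trans _ (leq_addl _ _)) // leq_double.
exists (fun i => contraction (Q i.*2)); split.
- by rewrite /= Q0 contraction0.
- move=> i /le2; rewrite doubleS => lim; have lim' := ltnW lim.
  have s12 := Qlt _ lim'; have s23 := Qlt _ lim.
  split; first by apply: contractionS; apply: subset_trans (proj1 s23); case: s12.
  by apply: no_three_chain s12 s23; apply: prQ => //; exact: ltnW.
- by move=> i /le2 lim; exact/contraction_prime/prQ.
- by move=> i /le2; exact: gQ.
Qed.

End Chains.
End Semistar.

(** * From chain lengths to the dimension inequalities *)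

Lemma prime_chain_le_dim (D : idomainType)
    (star : set {fraction D} -> set {fraction D}) n :
  prime_chain star n -> (n%:Z%:E <= star_dim star)%E.
Proof. by move=> cn; have [ub _] := star_dim_sup star; apply: ub; exists n. Qed.

Lemma star_dim_le (D : idomainType)
    (star : set {fraction D} -> set {fraction D}) x :
  (forall n, prime_chain star n -> (n%:Z%:E <= x)%E) -> (star_dim star <= x)%E.
Proof.
move=> ub; have [_ lb] := star_dim_sup star.
by apply: lb => _ [n cn <-]; exact: ub.
Qed.

Theorem theorem3p1 (D : idomainType) (star : semistar D) :
  let n := star_dim (star_tilde star) in
  n + 1 <= star_dim (star_X star) /\ star_dim (star_X star) <= 2%:E * n + 1.
Proof.
move=> n; split.
  (* Moving the finite term [1] to the right leaves the supremum [n] alone on the left, where it can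
     be bounded chain by chain, even when infinite. *)
  rewrite -leeBrDr //; apply: star_dim_le => k /prime_chain_lift/prime_chain_le_dim.
  by rewrite leeBrDr // -EFinD -PoszD addn1.
apply: star_dim_le => m cm.
have hm := prime_chain_le_dim (prime_chain_contract cm).
(* The halving loses at most the parity bit of [m], which the final [1] absorbs. *)
apply: (@le_trans _ _ (2%:E * (m./2)%:Z%:E + 1)).
  rewrite -EFinM -EFinD lee_fin -PoszM -PoszD lez_nat.
  rewrite -[X in (X <= _)%N]odd_double_half addnC -mul2n leq_add2l.
  by case: odd.
by rewrite leeD2r // lee_pmul2l.
Qed.
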